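(* Let $G$ be a countable discrete group equipped with a proper left-invariant metric $d$. Then $(G,d)$ has property A if and only if $(G,d)$ has naive property A.
   Context: A metric $d$ on a group $G$ is *left-invariant* if $d(gx,gy)=d(x,y)$ for all $g,x,y\in G$, and is *proper* (for $G$ discrete) if every ball of finite radius is finite. A discrete metric space $(X,d)$ has *property A* if for any $R,\varepsilon>0$ there exists a family $\{A_x\}_{x\in X}$ of finite, non-empty subsets of $X\times\mathbb{N}$ such that: (1) for any $x,y\in X$ with $d(x,y)\le R$, $\frac{|A_x\triangle A_y|}{|A_x\cap A_y|}<\varepsilon$; (2) there exists $S>0$ such that for any $x\in X$ and any $(y,n)\in A_x$, $d(x,y)\le S$. A discrete metric space $(X,d)$ has *naive property A* if for any $R,\varepsilon>0$ there exists a family $\{A_x\}_{x\in X}$ of finite, non-empty subsets of $X$ such that: (1) for any $x,y\in X$ with $d(x,y)\le R$, $\frac{|A_x\triangle A_y|}{|A_x\cap A_y|}<\varepsilon$; (2) there exists $S>0$ such that for any $x\in X$ and any $y\in A_x$, $d(x,y)\le S$. In both definitions, the inequality in (1) is understood to include that $A_x\cap A_y\neq\emptyset$. *)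

(* Defs.v *)
From HB Require Import structures.
From mathcomp Require Import all_boot all_order all_algebra finmap.
From mathcomp Require Import classical_sets cardinality reals topology.

Set Implicit Arguments.
Unset Strict Implicit.
Unset Printing Implicit Defensive.

Local Open Scope fset_scope.
Local Open Scope ring_scope.

(* The topology is the one induced by the distance; no compatibility between
   the distance and the multiplication is built in. *)
#[short(type="metricGroupType")]
HB.structure Definition MetricGroup (R : numDomainType) :=
  {G of Metric R G & Group G}.

(* Prop counterpart of discreteTopologicalType. *)
Definition discrete_space (X : topologicalType) : Prop :=
  @nbhs X X = principal_filter.

Definition left_invariant_metric (R : realType) (G : metricGroupType R) : Prop :=
  forall g x y : G, mdist (g * x)%g (g * y)%g = mdist x y.

Definition proper_metric (R : realType) (X : metricType R) : Prop :=
  forall (x : X) (r : R), finite_set (ball x r).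

Definition fsymdiff (T : choiceType) (A B : {fset T}) : {fset T} :=
  (A `\` B) `|` (B `\` A).

(* The first conjunct is not redundant: division by zero yields zero. *)
Definition symdiff_ratio_lt (R : realType) (T : choiceType) (eps : R)
    (A B : {fset T}) : Prop :=
  A `&` B != fset0 /\ #|` fsymdiff A B|%:R / #|` A `&` B|%:R < eps.

Definition property_A (R : realType) (X : metricType R) : Prop :=
  forall r eps : R, 0 < r -> 0 < eps ->
  exists A : X -> {fset X * nat},
    [/\ forall x, A x != fset0,
        forall x y, mdist x y <= r -> symdiff_ratio_lt eps (A x) (A y)
      & exists2 S : R, 0 < S &
        forall x y n, (y, n) \in A x -> mdist x y <= S].

Definition naive_property_A (R : realType) (X : metricType R) : Prop :=
  forall r eps : R, 0 < r -> 0 < eps ->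
  exists A : X -> {fset X},
    [/\ forall x, A x != fset0,
        forall x y, mdist x y <= r -> symdiff_ratio_lt eps (A x) (A y)
      & exists2 S : R, 0 < S &
        forall x y, y \in A x -> mdist x y <= S].

(* Main.v *)
Require Import Defs.
From mathcomp Require Import all_boot all_order all_algebra finmap ring lra zify.
From mathcomp Require Import boolp classical_sets cardinality reals topology.

(** Naive property A is property A with all the multiplicities at most one,
    so only the direction from property A to naive property A needs work.

    A finite group is its own witness: take [A_x = G] for every [x].  Suppose
    that [G] is infinite and that the sets [A_x], contained in [G * nat],
    witness property A with supports in balls of radius [S].

    Nothing bounds the second coordinates occurring in the [A_x], so the first
    step makes them bounded.  Let [a_x y] be the multiplicity of [y] in [A_x].
    The function [a_x / |A_x|] has sum 1, and when [A_x] and [A_y] are close in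
    ratio these normalised functions are close in l^1.  Rounding [M a_x / |A_x|]
    down to integers ([normalise]) costs at most 1 at each point of the support.
    The support lies in a ball, whose cardinality is bounded independently of
    [x] (left-invariance and properness), so for [M] large the rounding error is
    negligible against [M], which is about the size of the new sets.  All the
    second coordinates are now below [M] ([property_A_bounded]).

    The second step turns the [M] copies of each point into distinct points.
    Since [G] is infinite and balls are finite, there are [h_0, ..., h_(M-1)]
    at pairwise distance larger than any given [C] ([separated_points]).  Send
    [(y, i)] to [y h_i^-1].  If [u h_i^-1 = v h_j^-1 = c], then
    [d(u, v) = d(c h_i, c h_j) = d(h_i, h_j)], which exceeds [C] unless [i = j];
    so the map is injective on [A_x] union [A_y] whenever [x] and [y] are at
    distance at most [r], once [C] bounds the diameter of their supports.  The
    cardinalities of symmetric difference and intersection are then unchanged,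
    and points move by at most the largest distance from [1] to [h_i^-1]. *)

Set Implicit Arguments.
Unset Strict Implicit.
Unset Printing Implicit Defensive.

Import Order.TTheory GRing.Theory Num.Theory.

Local Open Scope fset_scope.
Local Open Scope ring_scope.

(** * Ratios of symmetric differences *)

(** The nonemptiness conjunct is absorbed by clearing the denominator: an empty
    intersection would force a negative cardinality. *)
Lemma symdiff_ratio_ltE (R : realType) (T : choiceType) (eps : R)
    (A B : {fset T}) :
  symdiff_ratio_lt eps A B <->
  #|` fsymdiff A B|%:R < eps * #|` A `&` B|%:R.
Proof.
split=> [[AB0]|H].
  by rewrite ltr_pdivrMr // ltr0n cardfs_gt0.
have AB0 : A `&` B != fset0.
  apply: contraTN H => /eqP ->.
  by rewrite cardfs0 mulr0 -leNgt ler0n.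
by split=> //; rewrite ltr_pdivrMr // ltr0n cardfs_gt0.
Qed.

Lemma card_fsymdiff (T : choiceType) (A B : {fset T}) :
  #|` fsymdiff A B| = (#|` A `\` B| + #|` B `\` A|)%N.
Proof.
rewrite -cardfsUI; suff -> : (A `\` B) `&` (B `\` A) = fset0.
  by rewrite cardfs0 addn0.
by apply/fsetP => x; rewrite !inE; case: (x \in A); case: (x \in B).
Qed.

Lemma symdiff_ratio_neq0 (R : realType) (T : choiceType) (eps : R)
    (A : {fset T}) : symdiff_ratio_lt eps A A -> A != fset0.
Proof. by case; rewrite fsetIid. Qed.

Lemma symdiff_ratio_imfset (R : realType) (T U : choiceType) (eps : R)
    (f : T -> U) (A B : {fset T}) :
  {in A `|` B &, injective f} ->
  symdiff_ratio_lt eps A B ->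
  symdiff_ratio_lt eps [fset f x | x in A] [fset f x | x in B].
Proof.
move=> finj /symdiff_ratio_ltE AB; apply/symdiff_ratio_ltE.
have cardf (C : {fset T}) : C `<=` A `|` B -> #|` [fset f x | x in C]| = #|` C|.
  move=> /fsubsetP CAB; rewrite card_in_imfset //= => x y xC yC.
  by apply: finj; apply: CAB.
have sA : A `<=` A `|` B := fsubsetUl A B.
have sB : B `<=` A `|` B := fsubsetUr A B.
have sI : A `&` B `<=` A `|` B := fsubset_trans (fsubsetIl A B) sA.
have fI : [fset f x | x in A] `&` [fset f x | x in B] = [fset f x | x in A `&` B].
  rewrite imfsetI // => x y xA yB.
  by apply: finj; [apply: (fsubsetP sA)|apply: (fsubsetP sB)].
move: AB; rewrite !card_fsymdiff !cardfsD fI.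
rewrite [[fset f x | x in B] `&` _]fsetIC fI [B `&` A]fsetIC.
by rewrite !cardf.
Qed.

(** * Multiplicities and their normalisation *)

Section Multiplicity.
Variable T : choiceType.
Implicit Types A B : {fset T * nat}.

Definition base A : {fset T} := [fset p.1 | p in A].

Definition mult A (y : T) : nat := #|` [fset p in A | p.1 == y]|.

Lemma mult_out A y : y \notin base A -> mult A y = 0%N.
Proof.
move=> yA; apply/eqP; rewrite cardfs_eq0; apply/eqP/fsetP => p.
rewrite !inE /=; apply/negbTE; apply: contra yA => /andP[pA /eqP <-].
by apply/imfsetP; exists p.
Qed.

Lemma sum_mult A (Y : {fset T}) : base A `<=` Y ->
  #|` A| = (\sum_(y <- Y) mult A y)%N.
Proof.
move=> AY; rewrite -(big_fset_incl _ AY); last by move=> y _; exact: mult_out.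
rewrite card_fset_sum1 (partition_big_imfset _ (fun p : T * nat => p.1)) /=.
apply: eq_bigr => y _.
by rewrite /mult card_fset_sum1 big_fset_condE.
Qed.

Lemma sum_mult_le A (Y : {fset T}) : (\sum_(y <- Y) mult A y <= #|` A|)%N.
Proof.
rewrite (sum_mult (fsubsetUl (base A) Y)).
rewrite [leqRHS](big_fsetID _ (mem Y)) /=.
rewrite (_ : [fset x in base A `|` Y | x \in Y] = Y) ?leq_addr //.
by apply/fsetP => x; rewrite !inE /=; case: (x \in Y); rewrite ?orbT ?andbF.
Qed.

(** Only an inequality: at the same point, [A] and [B] may have the same number
    of elements with different second coordinates. *)
Lemma multD A B y : (mult A y - mult B y <= mult (A `\` B) y)%N.
Proof.
rewrite leq_subLR /mult -cardfsUI.
apply: leq_trans (leq_addr _ _); apply/fsubset_leq_card/fsubsetP => p.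
by rewrite !inE /= => /andP[-> ->]; rewrite !andbT orbN.
Qed.

Definition columns (Y : {fset T}) (h : T -> nat) : {fset T * nat} :=
  [fset ((y, i) : T * nat) | y in Y, i in iota 0 (h y)].

Lemma in_columns Y h y i : ((y, i) \in columns Y h) = (y \in Y) && (i < h y)%N.
Proof.
apply/imfset2P/andP => /= [[z zY [j]]|[yY ih]].
  by rewrite mem_iota add0n /= => jh [-> ->].
by exists y => //; exists i => //; rewrite mem_iota.
Qed.

(** For columns that all start at height 0, the inequality [multD] becomes an
    equality.  The hypothesis on [k] lets its values be used also at points
    outside the base [Z]. *)
Lemma mult_columnsD (Y Z : {fset T}) (h k : T -> nat) y : y \in Y ->
  (y \notin Z -> k y = 0%N) ->
  mult (columns Y h `\` columns Z k) y = (h y - k y)%N.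
Proof.
move=> yY kZ; rewrite /mult.
rewrite (_ : [fset p in _ | _] = [fset (y, i) | i in iota (k y) (h y - k y)]).
  rewrite card_imfset /=; last by move=> i j [].
  by rewrite undup_id ?iota_uniq ?size_iota.
apply/fsetP => -[z i]; apply/idP/imfsetP => /= [|[j]].
  rewrite !inE /= !in_columns => /andP[/andP[nk /andP[_ ih]] /eqP zy].
  subst z; exists i => //; rewrite mem_iota.
  case: (boolP (y \in Z)) nk kZ => [_|_ _ ->] //=; lia.
rewrite mem_iota => jk [-> ->]; rewrite !inE /= !in_columns yY eqxx andbT.
by apply/andP; split; [apply/negP => /andP[_]|]; lia.
Qed.

Lemma mult_columns (Y : {fset T}) h y : y \in Y -> mult (columns Y h) y = h y.
Proof.
move=> yY; have := @mult_columnsD Y fset0 h (fun=> 0%N) y yY (fun=> erefl).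
rewrite subn0 => <-; congr mult; apply/fsetP => -[z i].
by rewrite !inE !in_columns inE.
Qed.

Lemma base_columns (Y : {fset T}) h : base (columns Y h) `<=` Y.
Proof.
apply/fsubsetP => y /imfsetP[[z i]] /=.
by rewrite in_columns => /andP[zY _] ->.
Qed.

(** The subgraph of the integer part of [M] times the probability density
    [mult A / |A|]. *)
Definition normalise (M : nat) A : {fset T * nat} :=
  columns (base A) (fun y => (M * mult A y) %/ #|` A|)%N.

Lemma normalise_bounded M A y n : (y, n) \in normalise M A -> (n < M)%N.
Proof.
rewrite in_columns => /andP[_] /leq_trans; apply.
have [->|A0] := eqVneq A fset0; first by rewrite cardfs0 divn0.
rewrite -ltnS ltn_divLR ?cardfs_gt0 //.
apply: leq_ltn_trans (_ : M * #|` A| < _)%N; last first.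
  by rewrite ltn_mul2r cardfs_gt0 A0 /=.
rewrite leq_mul2l fsubset_leq_card ?orbT //.
by apply/fsubsetP => p; rewrite !inE => /andP[].
Qed.

Lemma normalise_base M A y n : (y, n) \in normalise M A -> y \in base A.
Proof. by rewrite in_columns => /andP[]. Qed.

(** The rounding loses less than 1 at each point of the base, from a total mass
    of [M]. *)
Lemma card_normalise M A : A != fset0 ->
  (M <= #|` normalise M A| + #|` base A|)%N.
Proof.
move=> A0; have A_gt0 : (0 < #|` A|)%N by rewrite cardfs_gt0.
rewrite (sum_mult (base_columns _ _)) (card_fset_sum1 (base A)) -big_split /=.
rewrite -(leq_pmul2r A_gt0) {1}(sum_mult (fsubset_refl (base A))).
rewrite big_distrr big_distrl /= big_seq [leqRHS]big_seq; apply: leq_sum => y yA.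
by rewrite mult_columns // addn1 ltnW // ltn_ceil.
Qed.

(** The l^1-estimate for the normalised densities, plus the rounding error.
    With [a], [b] the multiplicities of a point and [p], [q] the cardinalities
    of [A], [B], the positive part of [a/p - b/q] is at most
    [((a - b)^+ + b (q - p)^+ / q) / p]; the terms [(a - b)^+] add up to at most
    the cardinality of [A \ B], the [b] to at most [q], and [(q - p)^+] is at
    most the cardinality of [B \ A]. *)
Lemma card_normaliseD (R : realType) M A B : A != fset0 -> B != fset0 ->
  #|` normalise M A `\` normalise M B|%:R <=
    M%:R * (#|` fsymdiff A B|%:R / #|` A|%:R) + #|` base A|%:R :> R.
Proof.
move=> A0 B0; have A_gt0 : (0 < #|` A|)%N by rewrite cardfs_gt0.
have B_gt0 : (0 < #|` B|)%N by rewrite cardfs_gt0.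
have pA : 0 < #|` A|%:R :> R by rewrite ltr0n.
have pB : 0 < #|` B|%:R :> R by rewrite ltr0n.
have sub : base (normalise M A `\` normalise M B) `<=` base A.
  apply/fsubsetP => y /imfsetP[[z n]] /=; rewrite inE => /andP[_ zA] ->.
  exact: normalise_base zA.
rewrite (sum_mult sub) natr_sum.
have pointwise y : y \in base A ->
    (mult (normalise M A `\` normalise M B) y)%:R <=
    M%:R / #|` A|%:R * ((mult (A `\` B) y)%:R +
      (mult B y)%:R * (#|` B `\` A|%:R / #|` B|%:R)) + 1 :> R.
  move=> yA; rewrite mult_columnsD //; last first.
    by move=> /mult_out ->; rewrite muln0 div0n.
  set a := mult A y; set b := mult B y.
  set p := #|` A|; set q := #|` B|.
  have ha : ((M * a) %/ p)%:R <= M%:R * a%:R / p%:R :> R.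
    by rewrite ler_pdivlMr // -!natrM ler_nat leq_divM.
  have hb : M%:R * b%:R / q%:R <= ((M * b) %/ q)%:R + 1 :> R.
    by rewrite ler_pdivrMr // natr1 -!natrM ler_nat ltnW // ltn_ceil.
  have hab : a%:R - b%:R <= (mult (A `\` B) y)%:R :> R.
    by rewrite lerBlDr -natrD ler_nat addnC -leq_subLR multD.
  have hpq : 1 - p%:R / q%:R <= #|` B `\` A|%:R / q%:R :> R.
    rewrite -{1}(divff (lt0r_neq0 pB)) -mulrBl ler_pM2r ?invr_gt0 //.
    rewrite lerBlDr -natrD ler_nat /q -(cardfsID A B) addnC leq_add2l.
    exact/fsubset_leq_card/fsubsetIr.
  have key : M%:R * a%:R / p%:R - M%:R * b%:R / q%:R <=
      M%:R / p%:R * ((mult (A `\` B) y)%:R + b%:R * (#|` B `\` A|%:R / q%:R)) :> R.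
    have -> : M%:R * a%:R / p%:R - M%:R * b%:R / q%:R =
        M%:R / p%:R * ((a%:R - b%:R) + b%:R * (1 - p%:R / q%:R)) :> R.
      by field; rewrite !lt0r_neq0.
    rewrite ler_wpM2l ?divr_ge0 ?ler0n // lerD // ler_wpM2l //.
  have rhs0 : 0 <= M%:R / p%:R * ((mult (A `\` B) y)%:R +
      b%:R * (#|` B `\` A|%:R / q%:R)) :> R.
    have nat_div_ge0 m n : 0 <= m%:R / n%:R :> R by rewrite divr_ge0.
    apply: mulr_ge0; first exact: nat_div_ge0.
    apply: addr_ge0; first exact: ler0n.
    by apply: mulr_ge0; [exact: ler0n|exact: nat_div_ge0].
  case: (leqP ((M * a) %/ p) ((M * b) %/ q)) => uv.
    by move: uv; rewrite -subn_eq0 => /eqP ->; apply: addr_ge0.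
  by rewrite natrB 1?ltnW //; lra.
apply: (@le_trans _ _ (\sum_(y <- base A)
    (M%:R / #|` A|%:R * ((mult (A `\` B) y)%:R +
      (mult B y)%:R * (#|` B `\` A|%:R / #|` B|%:R)) + 1))).
  by rewrite big_seq [leRHS]big_seq; apply: ler_sum.
rewrite big_split /= -mulr_sumr big_split /= -mulr_suml -!natr_sum.
have -> : \sum_(y <- base A) 1 = #|` base A|%:R :> R.
  by rewrite card_fset_sum1 natr_sum.
rewrite lerD2r [leRHS]mulrA [leRHS]mulrAC ler_wpM2l ?divr_ge0 ?ler0n //.
rewrite card_fsymdiff natrD lerD ?ler_nat ?sum_mult_le //.
rewrite mulrCA ler_piMr ?ler0n // ler_pdivrMr // mul1r ler_nat.
exact: sum_mult_le.
Qed.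

End Multiplicity.

(** * Bounding the multiplicities *)

(** Here [m] is the target mass and [k] the rounding error.  The symmetric
    difference has at most [4 delta m] elements and the intersection at least
    [(1 - 3 delta) m], and [8 delta] below [eps] and 1 is enough for the
    ratio. *)
Lemma symdiff_ratio_lt_of_bounds (R : realType) (T : choiceType)
    (eps delta m k : R) (A B : {fset T}) :
  0 < m -> k <= delta * m -> 0 < delta -> 8 * delta <= 1 -> 8 * delta <= eps ->
  m <= #|` A|%:R + k ->
  #|` A `\` B|%:R <= m * delta + k -> #|` B `\` A|%:R <= m * delta + k ->
  symdiff_ratio_lt eps A B.
Proof.
move=> m0 kdm d0 d1 de mA AB BA; apply/symdiff_ratio_ltE.
rewrite card_fsymdiff natrD.
have := cardfsID B A => /(congr1 (fun n => n%:R : R)); rewrite natrD => AE.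
have dm : 0 < delta * m by rewrite mulr_gt0.
have d8m : 8 * (delta * m) <= m by rewrite mulrA ler_piMl // ltW.
have Ige : m - 3 * (delta * m) <= #|` A `&` B|%:R :> R by lra.
apply: (@lt_le_trans _ _ (8 * delta * (m - 3 * (delta * m)))); last first.
  by apply: ler_pM => //; lra.
have : 8 * delta * (delta * m) <= delta * m by rewrite ler_piMl // ltW.
lra.
Qed.

Definition bounded_geometry (R : realType) (X : metricType R) : Prop :=
  forall S : R, exists K : nat, forall (x : X) (A : {fset X}),
    (forall y, y \in A -> mdist x y <= S) -> (#|` A| <= K)%N.

(** Bounded geometry is what makes the rounding error uniform in [x]: it bounds
    the support of [A x] by a constant [K], and [M] is chosen with
    [K <= delta * M]. *)
Lemma property_A_bounded (R : realType) (X : metricType R) (r eps : R) :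
  bounded_geometry X -> property_A X -> 0 < r -> 0 < eps ->
  exists (A : X -> {fset X * nat}) (S : R) (M : nat),
    [/\ 0 < S, forall x y, mdist x y <= r -> symdiff_ratio_lt eps (A x) (A y)
      & forall x y n, (y, n) \in A x -> mdist x y <= S /\ (n < M)%N].
Proof.
move=> geo propA r0 eps0.
pose delta := Num.min eps 1 / 8.
have d0 : 0 < delta by rewrite divr_gt0 // lt_min eps0 ltr01.
have d8 : 8 * delta = Num.min eps 1 by rewrite /delta mulrC divfK ?pnatr_eq0.
have d1 : 8 * delta <= 1 by rewrite d8 ge_min lexx orbT.
have de : 8 * delta <= eps by rewrite d8 ge_min lexx.
have [A [A0 Ar [S S0 AS]]] := propA r delta r0 d0.
have [K geoK] := geo S.
pose M := Num.bound (K%:R / delta).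
have KM : K%:R <= delta * M%:R.
  rewrite mulrC -ler_pdivrMr // ltW //.
  by apply: archi_boundP; rewrite divr_ge0 // ltW.
have M0 : 0 < M%:R :> R.
  by apply: (@le_lt_trans _ _ (K%:R / delta));
    [|apply: archi_boundP]; rewrite divr_ge0 // ltW.
have baseS x y : y \in base (A x) -> mdist x y <= S.
  by move=> /imfsetP[[z n]] /= /AS zS ->.
have baseK x : (#|` base (A x)| <= K)%N by apply: (geoK x) => y /baseS.
exists (fun x => normalise M (A x)), S, M; split => //; last first.
  move=> x y n yA; split; last exact: normalise_bounded yA.
  by apply: baseS; exact: normalise_base yA.
have half x y : mdist x y <= r ->
    #|` normalise M (A x) `\` normalise M (A y)|%:R <= M%:R * delta + K%:R.
  move=> /Ar /symdiff_ratio_ltE ratio.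
  apply: le_trans (card_normaliseD _ _ (A0 x) (A0 y)) _.
  rewrite lerD ?ler_nat // ler_wpM2l // ler_pdivrMr ?ltr0n ?cardfs_gt0 //.
  apply: le_trans (ltW ratio) _; rewrite ler_pM2l // ler_nat.
  exact/fsubset_leq_card/fsubsetIl.
move=> x y xy; apply: (symdiff_ratio_lt_of_bounds M0 KM) => //; last 2 first.
- exact: half.
- by apply: half; rewrite metric_sym.
rewrite -natrD ler_nat; apply: leq_trans (card_normalise M (A0 x)) _.
by rewrite leq_add2l.
Qed.

(** * Spreading the copies of a point over the group *)

(** Greedy choice: the balls around the points already chosen form a finite
    set, so an infinite space has a point outside it. *)
Lemma separated_points (R : realType) (X : metricType R) (C : R) (M : nat) :
  infinite_set [set: X] -> proper_metric X ->
  exists h : nat -> X, forall i j, (i < M)%N -> (j < M)%N ->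
    mdist (h i) (h j) <= C -> i = j.
Proof.
move=> Xinf Xprop; elim: M => [|M [h hsep]].
  by have [x _] := infinite_setN0 Xinf; exists (fun=> x).
pose U := (\bigcup_(i in `I_M) ball (h i) (C + 1))%classic.
have Ufin : finite_set U.
  by apply: bigcup_finite => [|i _]; [exact: finite_II|exact: Xprop].
have [z zU] : exists z, ~ U z.
  apply: contrapT => /forallNP H; apply: Xinf.
  by apply: sub_finite_set Ufin => z _; apply: contrapT; exact: H.
have zh i : (i < M)%N -> ~ mdist (h i) z <= C.
  move=> iM hz; apply: zU; exists i => //.
  by rewrite ballEmdist /=; lra.
exists (fun i => if i == M then z else h i) => i j.
rewrite !ltnS.
have [->|iM] := eqVneq i M; have [->|jM] := eqVneq j M => // iM' jM'.
- by rewrite metric_sym => /zh; apply: contra_notP => _; rewrite ltn_neqAle jM.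
- by move=> /zh; apply: contra_notP => _; rewrite ltn_neqAle iM.
- by apply: hsep; rewrite ltn_neqAle ?iM ?jM.
Qed.

Section LeftInvariant.
Variables (R : realType) (G : metricGroupType R).
Hypothesis (Gprop : proper_metric G) (Ginv : left_invariant_metric G).

(** All balls of the same radius are translates of the one around the unit. *)
Lemma group_bounded_geometry : bounded_geometry G.
Proof.
move=> S; have /finite_fsetP[B BE] := @Gprop 1%g (S + 1).
exists #|` B| => x A AS.
have -> : #|` A| = #|` [fset (x^-1 * y)%g | y in A]|.
  by rewrite card_imfset //; exact: mulgI.
apply/fsubset_leq_card/fsubsetP => z /imfsetP[y /= /AS yS ->].
suff : ball (1%g : G) (S + 1) (x^-1 * y)%g by rewrite BE.
by rewrite ballEmdist /= -(Ginv x) mulg1 mulVKg; lra.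
Qed.

(** The ratios survive because [spread] is injective on the union of [A x] and
    [A y] whenever [x] and [y] are at distance at most [r]. *)
Lemma naive_property_A_infinite : infinite_set [set: G] ->
  property_A G -> naive_property_A G.
Proof.
move=> Ginf propA r eps r0 eps0.
have [A [S [M [S0 Ar AS]]]] :=
  property_A_bounded group_bounded_geometry propA r0 eps0.
have [h hsep] := separated_points (S + r + (S + r)) M Ginf Gprop.
pose spread (p : G * nat) : G := (p.1 * (h p.2)^-1)%g.
have spread_inj x y : mdist x y <= r ->
    {in A x `|` A y &, injective spread}.
  (* [u] and [v] are the translates of [h i] and [h j] by the same element. *)
  move=> xy [u i] [v j].
  have near_x w n : (w, n) \in A x `|` A y -> mdist x w <= S + r /\ (n < M)%N.
    rewrite !inE => /orP[] /AS[wS nM]; split => //; first by lra.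
    by have := metric_triangle x y w; lra.
  move=> /near_x[uS iM] /near_x[vS jM]; rewrite /spread /= => uv.
  have ij : i = j.
    apply: hsep => //; rewrite -(Ginv (u * (h i)^-1)%g) {2}uv !mulgVK.
    by have := metric_triangle u x v; rewrite (metric_sym u x); lra.
  by move: uv; rewrite ij => /mulIg ->.
pose B x := [fset spread p | p in A x].
have Br x y : mdist x y <= r -> symdiff_ratio_lt eps (B x) (B y).
  by move=> xy; apply: symdiff_ratio_imfset; [exact: spread_inj|exact: Ar].
exists B; split => //.
  by move=> x; apply: (@symdiff_ratio_neq0 R _ eps); apply: Br; rewrite mdistxx ltW.
(* The sum is a convenient upper bound of all the displacements. *)
exists (S + \sum_(i < M) mdist 1%g (h i)^-1%g).
  by rewrite ltr_wpDr // sumr_ge0 // => i _; exact: mdist_ge0.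
move=> x z /imfsetP[[u i] /= /AS[uS iM] ->].
apply: le_trans (metric_triangle _ u _) _; rewrite lerD //.
rewrite /spread /= -[X in mdist X _]mulg1 Ginv (bigD1 (Ordinal iM)) //=.
by rewrite lerDl sumr_ge0 // => k _; exact: mdist_ge0.
Qed.

Lemma naive_property_A_finite : finite_set [set: G] -> naive_property_A G.
Proof.
move=> /finite_fsetP[Y YE] r eps r0 eps0.
have inY y : y \in Y by have : [set: G]%classic y by []; rewrite YE.
exists (fun=> Y); split=> [x|x y _|].
- by apply/fset0Pn; exists x.
- apply/symdiff_ratio_ltE; rewrite card_fsymdiff fsetDv cardfs0 addn0 fsetIid.
  by rewrite mulr_gt0 // ltr0n cardfs_gt0; apply/fset0Pn; exists x.
exists (1 + \sum_(y <- Y) mdist 1%g y).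
  by rewrite ltr_wpDr // sumr_ge0 // => y _; exact: mdist_ge0.
move=> x y _; rewrite -(Ginv x^-1%g) mulVg (big_fsetD1 (x^-1 * y)%g) //=.
have := mdist_ge0 (1%g : G) (x^-1 * y)%g.
have : 0 <= \sum_(i <- Y `\ (x^-1 * y)%g) mdist (1%g : G) i.
  by apply: sumr_ge0 => i _; exact: mdist_ge0.
lra.
Qed.

End LeftInvariant.

Lemma naive_property_A_property_A (R : realType) (X : metricType R) :
  naive_property_A X -> property_A X.
Proof.
move=> naive r eps r0 eps0; have [A [A0 Ar [S S0 AS]]] := naive r eps r0 eps0.
exists (fun x => [fset ((y, 0%N) : X * nat) | y in A x]); split => [x|x y xy|].
- have /fset0Pn[y yA] := A0 x.
  by apply/fset0Pn; exists (y, 0%N); apply/imfsetP; exists y.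
- by apply: symdiff_ratio_imfset; [move=> u v _ _ []|exact: Ar].
by exists S => // x y n /imfsetP[z /= zA [-> _]]; exact: AS.
Qed.

Local Open Scope classical_set_scope.

Theorem theoremD (R : realType) (G : metricGroupType R) :
  countable [set: G] -> discrete_space G ->
  proper_metric G -> left_invariant_metric G ->
  (property_A G <-> naive_property_A G).
Proof.
move=> _ _ Gprop Ginv; split; last exact: naive_property_A_property_A.
have [Gfin _|Ginf] := pselect (finite_set [set: G]).
- exact: naive_property_A_finite.
- exact: naive_property_A_infinite.
Qed.
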